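(* Let $A\in\{\mathbb{C},\mathbb{H},\mathbb{O}\}$, let $\Omega\subseteq A$ be a circular set and let $f,g\in\mathcal{S}(\Omega)$. If $x\in\Omega$ is real and $x\in V(f)\cup V(g)$, then $x\in V(f\cdot g)$. More generally, for all $x\in\Omega$: 1. If $\mathbb{S}_x\subseteq V(f)$ or $\mathbb{S}_x\subseteq V(g)$, then $\mathbb{S}_x\subseteq V(f\cdot g)$. If $x\in\Omega\setminus\mathbb{R}$, then: 2. If $\mathbb{S}_x\cap V(f)$ is a singleton $\{y\}$ and $\mathbb{S}_x\cap V(g)=\emptyset$, then $\mathbb{S}_x\cap V(f\cdot g)=\{w\}$, with $$w=\big((yf'_s(x))\,g_s^\circ(x)-(y\operatorname{im}(y)f'_s(x))\,g'_s(x)\big)\big(f'_s(x)\,g_s^\circ(x)-(\operatorname{im}(y)f'_s(x))\,g'_s(x)\big)^{-1}.$$ 3. If $\mathbb{S}_x\cap V(f)=\emptyset$ and $\mathbb{S}_x\cap V(g)$ is a singleton $\{z\}$, then $\mathbb{S}_x\cap V(f\cdot g)=\{w\}$, with $$w=\big(f_s^\circ(x)(zg'_s(x))-f'_s(x)(z\operatorname{im}(z)g'_s(x))\big)\big(f_s^\circ(x)g'_s(x)-f'_s(x)(\operatorname{im}(z)g'_s(x))\big)^{-1}.$$ 4. If $\mathbb{S}_x\cap V(f)=\{y\}$ and $\mathbb{S}_x\cap V(g)=\{z\}$ for some $y,z\in\mathbb{S}_x$, then one of the following holds: (a) $\mathbb{S}_x\subseteq V(f\cdot g)$; or (b) $\mathbb{S}_x\cap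 V(f\cdot g)=\{w\}$, with $$w=\big(n(x)f'_s(x)g'_s(x)-(yf'_s(x))(zg'_s(x))\big)\big((f\cdot g)'_s(x)\big)^{-1};$$ case (a) or case (b) holds depending on whether or not, respectively, $(f\cdot g)'_s(x)=(y^cf'_s(x))g'_s(x)-f'_s(x)(zg'_s(x))$ vanishes.
   Context: $A$ is one of the real $*$-algebras $\mathbb{C},\mathbb{H},\mathbb{O}$ (complex numbers, quaternions, octonions) with standard conjugation $x\mapsto x^c$; $n(x)=xx^c=|x|^2$; $\operatorname{im}(x)=(x-x^c)/2$; $\mathbb{S}=\{w\in A: w^2=-1\}$; every $x\in A$ can be written $x=\alpha+\beta J$ with $\alpha,\beta\in\mathbb{R}$, $J\in\mathbb{S}$, and then $\mathbb{S}_x=\{\alpha+\beta I: I\in\mathbb{S}\}$. For nonempty $D\subseteq\mathbb{C}$ invariant under complex conjugation, $\Omega_D=\{\alpha+\beta J:\alpha,\beta\in\mathbb{R},\,J\in\mathbb{S},\,\alpha+i\beta\in D\}$; sets of this form are called circular. Let $\Omega=\Omega_D$. A function $f:\Omega\to A$ is a slice function if there are $F_1,F_2:D\to A$ with $F_1(\bar z)=F_1(z)$, $F_2(\bar z)=-F_2(z)$ and $f(\alpha+\beta J)=F_1(\alpha+i\beta)+JF_2(\alpha+i\beta)$ for all $\alpha+i\beta\in D$, $J\in\mathbb{S}$ ($F_1,F_2$ are determined by $f$). $\mathcal{S}(\Omega)$ is the set of slice functions on $\Omega$. If $f,g$ correspond to $(F_1,F_2),(G_1,G_2)$, the slice product $f\cdot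 g$ corresponds to $(F_1G_1-F_2G_2,\;F_1G_2+F_2G_1)$. $V(f)=\{x\in\Omega: f(x)=0\}$. The spherical value $f_s^\circ:\Omega\to A$ and the spherical derivative $f'_s:\Omega\setminus\mathbb{R}\to A$ are $f_s^\circ(x)=\frac12(f(x)+f(x^c))$ and $f'_s(x)=\frac12\operatorname{im}(x)^{-1}(f(x)-f(x^c))$; they are constant on each $\mathbb{S}_x$ (with $x\notin\mathbb{R}$) and $f(x)=f_s^\circ(x)+\operatorname{im}(x)f'_s(x)$. Products written without parentheses, such as $y\operatorname{im}(y)f'_s(x)$, are unambiguous since the subalgebra generated by two elements is associative. *)

(* Defs.v *)
From HB Require Import structures.
From mathcomp Require Import all_boot all_order all_algebra.
From mathcomp Require Import complex.
From mathcomp Require Import all_classical reals.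
From mathcomp Require Import ring.
Set Implicit Arguments.
Unset Strict Implicit.
Unset Printing Implicit Defensive.
Import Order.TTheory GRing.Theory Num.Theory.
Local Open Scope classical_set_scope.
Local Open Scope ring_scope.

(* The product is not assumed associative, so MathComp's algebra structures
   (which would exclude the octonions) do not apply. [sa_re] is the real part,
   which is used to see n(x) = x x^c as an element of R. *)
Record starAlg (R : realType) := StarAlg {
  sa_car :> lmodType R;
  sa_one : sa_car;
  sa_mul : sa_car -> sa_car -> sa_car;
  sa_conj : sa_car -> sa_car;
  sa_re : sa_car -> R
}.

Notation "x ** y" := (sa_mul x y) (at level 40, left associativity) : ring_scope.
Notation "x ^c" := (sa_conj x) : ring_scope.

(* [Rcomplex R] is R[i] with its structure of vector space over R. *)
Definition complexAlg (R : realType) : starAlg R :=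
  @StarAlg R (Rcomplex R) (1 : R[i]) (fun x y : R[i] => x * y) (@complex.conjc R) (@complex.Re R).

(* Cayley-Dickson doubling. *)
Definition doubleAlg (R : realType) (B : starAlg R) : starAlg R :=
  @StarAlg R (B * B)%type (sa_one B, 0)
    (fun x y => (x.1 ** y.1 - y.2^c ** x.2, y.2 ** x.1 + x.2 ** y.1^c))
    (fun x => (x.1^c, - x.2))
    (fun x => sa_re x.1).

Definition quaternionAlg (R : realType) : starAlg R := doubleAlg (complexAlg R).
Definition octonionAlg (R : realType) : starAlg R := doubleAlg (quaternionAlg R).

Section Slice.
Variables (R : realType) (A : starAlg R).
Implicit Types (x y J : A) (D : set R[i]) (f g h : A -> A) (F G : R[i] -> A).

Definition of_real (a : R) : A := a *: sa_one A.
Definition real_axis : set A := range of_real.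
Definition sa_im x : A := 2^-1 *: (x - x^c).

(* n(x) = x x^c, as a real number; see [mul_conj] below. *)
Definition nsq x : R := sa_re (x ** x^c).

(* The multiplicative inverse of x <> 0 (and 0 for x = 0). *)
Definition sa_inv x : A := (nsq x)^-1 *: x^c.

Definition imag_units : set A := [set w | w ** w = - sa_one A].

Definition slice_sphere x : set A :=
  [set y | exists a b J I, [/\ imag_units J, imag_units I,
     x = of_real a + b *: J & y = of_real a + b *: I]].

Definition conj_invariant D : Prop := forall z, D z -> D (complex.conjc z).

Definition circularization D : set A :=
  [set x | exists a b J,
     [/\ imag_units J, D (Complex a b) & x = of_real a + b *: J]].

(* Functions on D or on Omega_D are represented by total functions whose values
   outside that set are irrelevant. *)
Definition stem D F1 F2 : Prop :=
  forall z, D z -> F1 (complex.conjc z) = F1 z /\ F2 (complex.conjc z) = - F2 z.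

Definition induces D F1 F2 f : Prop :=
  forall a b J, D (Complex a b) -> imag_units J ->
    f (of_real a + b *: J) = F1 (Complex a b) + J ** F2 (Complex a b).

Definition slice_fun D f : Prop :=
  exists F1 F2, stem D F1 F2 /\ induces D F1 F2 f.

Definition is_slice_prod D f g h : Prop :=
  exists F1 F2 G1 G2,
    [/\ stem D F1 F2 /\ induces D F1 F2 f,
        stem D G1 G2 /\ induces D G1 G2 g &
        induces D (fun z => F1 z ** G1 z - F2 z ** G2 z)
                  (fun z => F1 z ** G2 z + F2 z ** G1 z) h].

(* The slice product, which is determined on Omega_D by [is_slice_prod]. *)
Definition slice_prod D f g : A -> A :=
  xget (fun=> 0) [set h | is_slice_prod D f g h].

Definition zeros D f : set A := [set x | circularization D x /\ f x = 0].

Definition sph_val f x : A := 2^-1 *: (f x + f x^c).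
Definition sph_der f x : A := 2^-1 *: (sa_inv (sa_im x) ** (f x - f x^c)).

End Slice.

Definition is_CHO (R : realType) (A : starAlg R) : Prop :=
  [\/ A = complexAlg R, A = quaternionAlg R | A = octonionAlg R].

Lemma mul_conj (R : realType) (A : starAlg R) (x : A) :
  is_CHO A -> x ** x^c = of_real A (nsq x).
Proof.
have eqC (u v : R[i]) :
  complex.Re u = complex.Re v -> complex.Im u = complex.Im v -> u = v.
  by case: u v => [a b] [c d] /= -> ->.
have eqD (B : starAlg R) (u v : doubleAlg B) :
  u.1 = v.1 -> u.2 = v.2 -> u = v.
  by case: u v => [a b] [c d] /= -> ->.
case=> eA; move: x; rewrite {}eA.
- by move=> [a b]; apply: eqC; rewrite /of_real /nsq /=; ring.
- move=> [[a b] [c d]].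
  by apply: eqD; apply: eqC; rewrite /of_real /nsq /=; ring.
- move=> [[[a b] [c d]] [[a' b'] [c' d']]].
  by do 2!apply: (@eqD); apply: eqC; rewrite /of_real /nsq /=; ring.
Qed.

(* Main.v *)
(* On a sphere S_x a slice function is affine, h(y) = p + im(y) q, with p and q its
   spherical value and derivative, and in a composition algebra such a function with
   q <> 0 has a zero on S_x (which is then unique) exactly when -p q^-1 is imaginary
   of norm |im x|, that is, when <p, q> = 0 and |p| = |im x| |q|. For a slice product
   whose factors vanish somewhere on the sphere these two conditions follow from the
   identity <px, qy> + <py, qx> = 2 <p, q> <x, y>, which needs no associativity,
   because <v b, b> = 0 for imaginary v. The denominator q cannot vanish in cases 2
   and 3, since this would force the factor without zeros to satisfy the same two
   conditions. *)

Require Import Defs.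
From mathcomp Require Import all_boot all_order all_algebra.
From mathcomp Require Import complex.
From mathcomp Require Import all_classical reals.
From mathcomp Require Import ring lra.
Set Implicit Arguments.
Unset Strict Implicit.
Unset Printing Implicit Defensive.
Import Order.TTheory GRing.Theory Num.Theory.
Local Open Scope classical_set_scope.
Local Open Scope ring_scope.

Lemma complexAlg_ext (R : realType) (u v : complexAlg R) :
  complex.Re u = complex.Re v -> complex.Im u = complex.Im v -> u = v.
Proof. by case: u v => [a b] [c d] /= -> ->. Qed.

Lemma doubleAlg_ext (R : realType) (B : starAlg R) (u v : doubleAlg B) :
  u.1 = v.1 -> u.2 = v.2 -> u = v.
Proof. by case: u v => [a b] [c d] /= -> ->. Qed.

(** Elements are nested pairs of reals, so an identity in the algebra splits into at most eight
    polynomial identities over R; real-valued goals go directly to [ring]. *)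
Ltac coordinates :=
  do ?apply: doubleAlg_ext; do ?apply: complexAlg_ext; rewrite /of_real /nsq /=; ring.

(** * The composition algebras C, H and O *)

Section CompositionAlgebra.
Variables (R : realType) (A : starAlg R).
Hypothesis hA : is_CHO A.
Implicit Types (x y z p q u v J I : A) (k : R).

Lemma sa_mulDl x y z : (x + y) ** z = x ** z + y ** z.
Proof.
move: x y z; case: hA => ->.
- by move=> [? ?] [? ?] [? ?]; coordinates.
- by move=> [[? ?] [? ?]] [[? ?] [? ?]] [[? ?] [? ?]]; coordinates.
- by move=> [[[? ?] [? ?]] [[? ?] [? ?]]] [[[? ?] [? ?]] [[? ?] [? ?]]]
    [[[? ?] [? ?]] [[? ?] [? ?]]]; coordinates.
Qed.

Lemma sa_mulDr z x y : z ** (x + y) = z ** x + z ** y.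
Proof.
move: z x y; case: hA => ->.
- by move=> [? ?] [? ?] [? ?]; coordinates.
- by move=> [[? ?] [? ?]] [[? ?] [? ?]] [[? ?] [? ?]]; coordinates.
- by move=> [[[? ?] [? ?]] [[? ?] [? ?]]] [[[? ?] [? ?]] [[? ?] [? ?]]]
    [[[? ?] [? ?]] [[? ?] [? ?]]]; coordinates.
Qed.

Lemma sa_mulZl k x y : (k *: x) ** y = k *: (x ** y).
Proof.
move: x y; case: hA => ->.
- by move=> [? ?] [? ?]; coordinates.
- by move=> [[? ?] [? ?]] [[? ?] [? ?]]; coordinates.
- by move=> [[[? ?] [? ?]] [[? ?] [? ?]]] [[[? ?] [? ?]] [[? ?] [? ?]]]; coordinates.
Qed.

Lemma sa_mulZr k x y : x ** (k *: y) = k *: (x ** y).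
Proof.
move: x y; case: hA => ->.
- by move=> [? ?] [? ?]; coordinates.
- by move=> [[? ?] [? ?]] [[? ?] [? ?]]; coordinates.
- by move=> [[[? ?] [? ?]] [[? ?] [? ?]]] [[[? ?] [? ?]] [[? ?] [? ?]]]; coordinates.
Qed.

Lemma sa_mul1l x : sa_one A ** x = x.
Proof.
move: x; case: hA => ->.
- by move=> [? ?]; coordinates.
- by move=> [[? ?] [? ?]]; coordinates.
- by move=> [[[? ?] [? ?]] [[? ?] [? ?]]]; coordinates.
Qed.

Lemma sa_mul1r x : x ** sa_one A = x.
Proof.
move: x; case: hA => ->.
- by move=> [? ?]; coordinates.
- by move=> [[? ?] [? ?]]; coordinates.
- by move=> [[[? ?] [? ?]] [[? ?] [? ?]]]; coordinates.
Qed.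

Lemma sa_reD x y : sa_re (x + y) = sa_re x + sa_re y.
Proof.
move: x y; case: hA => ->.
- by move=> [? ?] [? ?].
- by move=> [[? ?] [? ?]] [[? ?] [? ?]].
- by move=> [[[? ?] [? ?]] [[? ?] [? ?]]] [[[? ?] [? ?]] [[? ?] [? ?]]].
Qed.

Lemma sa_reZ k x : sa_re (k *: x) = k * sa_re x.
Proof.
move: x; case: hA => ->.
- by move=> [? ?].
- by move=> [[? ?] [? ?]].
- by move=> [[[? ?] [? ?]] [[? ?] [? ?]]].
Qed.

Lemma sa_re1 : sa_re (sa_one A) = 1.
Proof. by case: hA => ->. Qed.

Lemma sa_conjE x : x^c = (2 * sa_re x) *: sa_one A - x.
Proof.
move: x; case: hA => ->.
- by move=> [? ?]; coordinates.
- by move=> [[? ?] [? ?]]; coordinates.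
- by move=> [[[? ?] [? ?]] [[? ?] [? ?]]]; coordinates.
Qed.

Lemma sa_re_mul_conjC x y : sa_re (x ** y^c) = sa_re (y ** x^c).
Proof.
move: x y; case: hA => ->.
- by move=> [? ?] [? ?]; coordinates.
- by move=> [[? ?] [? ?]] [[? ?] [? ?]]; coordinates.
- by move=> [[[? ?] [? ?]] [[? ?] [? ?]]] [[[? ?] [? ?]] [[? ?] [? ?]]]; coordinates.
Qed.

Lemma nsq_ge0 x : 0 <= nsq x.
Proof.
move: x; case: hA => ->.
- move=> [a b].
  have -> : nsq (Complex a b : complexAlg R) = a ^+ 2 + b ^+ 2 by coordinates.
  by rewrite !addr_ge0 ?sqr_ge0.
- move=> [[a b] [c d]]; set x := (X in nsq X).
  have -> : nsq (x : quaternionAlg R) = a ^+ 2 + b ^+ 2 + c ^+ 2 + d ^+ 2.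
    by coordinates.
  by rewrite !addr_ge0 ?sqr_ge0.
- move=> [[[a b] [c d]] [[a' b'] [c' d']]]; set x := (X in nsq X).
  have -> : nsq (x : octonionAlg R) = a ^+ 2 + b ^+ 2 + c ^+ 2 + d ^+ 2
    + a' ^+ 2 + b' ^+ 2 + c' ^+ 2 + d' ^+ 2 by coordinates.
  by rewrite !addr_ge0 ?sqr_ge0.
Qed.

(** The two, four and eight square identities. Their polarizations below stand in for
    associativity. *)
Lemma nsqM x y : nsq (x ** y) = nsq x * nsq y.
Proof.
move: x y; case: hA => ->.
- by move=> [? ?] [? ?]; coordinates.
- by move=> [[? ?] [? ?]] [[? ?] [? ?]]; coordinates.
- by move=> [[[? ?] [? ?]] [[? ?] [? ?]]] [[[? ?] [? ?]] [[? ?] [? ?]]]; coordinates.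
Qed.

Lemma nsq_eq0 x : nsq x = 0 -> x = 0.
Proof.
move: x; case: hA => ->.
- move=> [a b] h.
  have {h} : a ^+ 2 + b ^+ 2 = 0 by rewrite -h; coordinates.
  move/eqP; rewrite !paddr_eq0 ?addr_ge0 ?sqr_ge0 // !sqrf_eq0.
  by do ![case/andP]; do !move=> /eqP ->.
- move=> [[a b] [c d]] h.
  have {h} : a ^+ 2 + b ^+ 2 + c ^+ 2 + d ^+ 2 = 0 by rewrite -h; coordinates.
  move/eqP; rewrite !paddr_eq0 ?addr_ge0 ?sqr_ge0 // !sqrf_eq0.
  by do ![case/andP]; do !move=> /eqP ->.
- move=> [[[a b] [c d]] [[a' b'] [c' d']]] h.
  have {h} : a ^+ 2 + b ^+ 2 + c ^+ 2 + d ^+ 2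
           + a' ^+ 2 + b' ^+ 2 + c' ^+ 2 + d' ^+ 2 = 0 by rewrite -h; coordinates.
  move/eqP; rewrite !paddr_eq0 ?addr_ge0 ?sqr_ge0 // !sqrf_eq0.
  by do ![case/andP]; do !move=> /eqP ->.
Qed.

(** By alternativity x and y generate an associative subalgebra, which contains x^c. This identity
    and the next two justify cancelling inverses. *)
Lemma mul_conjK x y : x^c ** (x ** y) = nsq x *: y.
Proof.
move: x y; case: hA => ->.
- by move=> [? ?] [? ?]; coordinates.
- by move=> [[? ?] [? ?]] [[? ?] [? ?]]; coordinates.
- by move=> [[[? ?] [? ?]] [[? ?] [? ?]]] [[[? ?] [? ?]] [[? ?] [? ?]]]; coordinates.
Qed.

Lemma mul_conjrK x y : (y ** x) ** x^c = nsq x *: y.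
Proof.
move: x y; case: hA => ->.
- by move=> [? ?] [? ?]; coordinates.
- by move=> [[? ?] [? ?]] [[? ?] [? ?]]; coordinates.
- by move=> [[[? ?] [? ?]] [[? ?] [? ?]]] [[[? ?] [? ?]] [[? ?] [? ?]]]; coordinates.
Qed.

Lemma mul_conjVK x y : (y ** x^c) ** x = nsq x *: y.
Proof.
move: x y; case: hA => ->.
- by move=> [? ?] [? ?]; coordinates.
- by move=> [[? ?] [? ?]] [[? ?] [? ?]]; coordinates.
- by move=> [[[? ?] [? ?]] [[? ?] [? ?]]] [[[? ?] [? ?]] [[? ?] [? ?]]]; coordinates.
Qed.

Lemma sa_mulNl x y : (- x) ** y = - (x ** y).
Proof. by rewrite -scaleN1r sa_mulZl scaleN1r. Qed.

Lemma sa_mulNr x y : x ** (- y) = - (x ** y).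
Proof. by rewrite -scaleN1r sa_mulZr scaleN1r. Qed.

Lemma sa_mul0l x : 0 ** x = 0 :> A.
Proof. by have := sa_mulZl 0 0 x; rewrite !scale0r. Qed.

Lemma sa_mul0r x : x ** 0 = 0 :> A.
Proof. by have := sa_mulZr 0 x 0; rewrite !scale0r. Qed.

Lemma sa_mulBl x y z : (x - y) ** z = x ** z - y ** z.
Proof. by rewrite sa_mulDl sa_mulNl. Qed.

Lemma sa_mulBr z x y : z ** (x - y) = z ** x - z ** y.
Proof. by rewrite sa_mulDr sa_mulNr. Qed.

Lemma of_realM k x : of_real A k ** x = k *: x.
Proof. by rewrite /of_real sa_mulZl sa_mul1l. Qed.

Lemma sa_reN x : sa_re (- x) = - sa_re x.
Proof. by rewrite -scaleN1r sa_reZ mulN1r. Qed.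

Lemma sa_re_of_real k : sa_re (of_real A k) = k.
Proof. by rewrite /of_real sa_reZ sa_re1 mulr1. Qed.

Lemma sa_imE x : sa_im x = x - of_real A (sa_re x).
Proof.
rewrite /sa_im sa_conjE opprB addrA -mulr2n -scaler_nat scalerBr !scalerA.
by rewrite mulrA mulVf ?pnatr_eq0 // mul1r scale1r /of_real.
Qed.

Lemma sa_re_im_decomp x : x = of_real A (sa_re x) + sa_im x.
Proof. by rewrite sa_imE addrC subrK. Qed.

Lemma sa_re_im x : sa_re (sa_im x) = 0.
Proof. by rewrite sa_imE sa_reD sa_reN sa_re_of_real subrr. Qed.

Lemma conj_re0 u : sa_re u = 0 -> u^c = - u.
Proof. by move=> u0; rewrite sa_conjE u0 mulr0 scale0r add0r. Qed.

Lemma conj_decomp k u : sa_re u = 0 -> (of_real A k + u)^c = of_real A k - u.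
Proof.
move=> u0; rewrite sa_conjE sa_reD sa_re_of_real u0 addr0 opprD addrA.
by rewrite /of_real -scalerBl; congr (_ *: _ - _); ring.
Qed.

Lemma sa_re_decomp k u : sa_re u = 0 -> sa_re (of_real A k + u) = k.
Proof. by move=> u0; rewrite sa_reD sa_re_of_real u0 addr0. Qed.

Lemma sa_im_decomp k u : sa_re u = 0 -> sa_im (of_real A k + u) = u.
Proof. by move=> u0; rewrite sa_imE sa_re_decomp // addrAC subrr add0r. Qed.

Lemma mul_re0 u : sa_re u = 0 -> u ** u = - (nsq u *: sa_one A).
Proof.
by move=> u0; rewrite -[_ *: _](mul_conj u hA) conj_re0 // sa_mulNr opprK.
Qed.

Lemma sa_im_conj x : sa_im x^c = - sa_im x.
Proof.
have u0 := sa_re_im x.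
by rewrite {1}(sa_re_im_decomp x) conj_decomp // sa_im_decomp // sa_reN u0 oppr0.
Qed.

(** * The inner product polarizing the norm form *)

Definition ip x y : R := sa_re (x ** y^c).

Lemma ipC x y : ip x y = ip y x.
Proof. exact: sa_re_mul_conjC. Qed.

Lemma ipxx x : ip x x = nsq x.
Proof. by []. Qed.

Lemma ipDl x y z : ip (x + y) z = ip x z + ip y z.
Proof. by rewrite /ip sa_mulDl sa_reD. Qed.

Lemma ipZl k x y : ip (k *: x) y = k * ip x y.
Proof. by rewrite /ip sa_mulZl sa_reZ. Qed.

Lemma ipNl x y : ip (- x) y = - ip x y.
Proof. by rewrite /ip sa_mulNl sa_reN. Qed.

Lemma ipDr z x y : ip z (x + y) = ip z x + ip z y.
Proof. by rewrite ipC ipDl !(ipC z). Qed.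

Lemma ipZr k x y : ip x (k *: y) = k * ip x y.
Proof. by rewrite ipC ipZl ipC. Qed.

Lemma ipNr x y : ip x (- y) = - ip x y.
Proof. by rewrite ipC ipNl ipC. Qed.

Definition ipE := (ipDl, ipDr, ipNl, ipNr, ipZl, ipZr).

Lemma nsqD x y : nsq (x + y) = nsq x + 2 * ip x y + nsq y.
Proof. by rewrite -!ipxx !ipE (ipC y x); ring. Qed.

Lemma nsqZ k x : nsq (k *: x) = k ^+ 2 * nsq x.
Proof. by rewrite -!ipxx !ipE; ring. Qed.

Lemma nsqN x : nsq (- x) = nsq x.
Proof. by rewrite -!ipxx !ipE; ring. Qed.

Lemma nsq0 : nsq (0 : A) = 0.
Proof. by rewrite -(scale0r (0 : A)) nsqZ expr0n mul0r. Qed.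

Lemma nsq1 : nsq (sa_one A) = 1.
Proof.
by rewrite -ipxx /ip sa_mul1l sa_conjE sa_reD sa_reN sa_reZ sa_re1; ring.
Qed.

Lemma nsq_neq0 x : x <> 0 -> nsq x != 0.
Proof. by move=> x0; apply/eqP => /nsq_eq0. Qed.

(** (v b) b^c = n(b) v is imaginary: left multiplication by an imaginary element is
    skew-symmetric. *)
Lemma ip_re0 v b : sa_re v = 0 -> ip (v ** b) b = 0.
Proof. by move=> v0; rewrite /ip mul_conjrK sa_reZ v0 mulr0. Qed.

Lemma nsq_re_im x : nsq x = sa_re x ^+ 2 + nsq (sa_im x).
Proof.
(* With b = 1 this is the orthogonality of 1 and im(x). *)
have e := ip_re0 (sa_one A) (sa_re_im x); rewrite sa_mul1r in e.
rewrite {1}(sa_re_im_decomp x) nsqD nsqZ ipZl ipC e nsq1; ring.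
Qed.

(** Compare the cross terms in n(p (x + y)) = n(p) n(x + y). *)
Lemma ip_mul2l p x y : ip (p ** x) (p ** y) = nsq p * ip x y.
Proof.
have := nsqM p (x + y).
by rewrite sa_mulDr !nsqD !nsqM => ?; lra.
Qed.

Lemma ip_mul2r p x y : ip (x ** p) (y ** p) = nsq p * ip x y.
Proof.
have := nsqM (x + y) p.
by rewrite sa_mulDl !nsqD !nsqM => ?; lra.
Qed.

(* Polarization of [nsqM] in both factors. *)
Lemma ip_mul_exchange p q x y :
  ip (p ** x) (q ** y) + ip (p ** y) (q ** x) = 2 * ip p q * ip x y.
Proof.
have := ip_mul2l (p + q) x y.
rewrite !sa_mulDl !ipDl !ipDr !ip_mul2l nsqD (ipC (q ** x)) => h; lra.
Qed.

Lemma sa_mulVK x y : y <> 0 -> (x ** sa_inv y) ** y = x.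
Proof.
move=> y0; rewrite /sa_inv sa_mulZr sa_mulZl mul_conjVK scalerA.
by rewrite mulVf ?nsq_neq0 // scale1r.
Qed.

Lemma sa_mulK x y : y <> 0 -> (x ** y) ** sa_inv y = x.
Proof.
move=> y0; rewrite /sa_inv sa_mulZr mul_conjrK scalerA.
by rewrite mulVf ?nsq_neq0 // scale1r.
Qed.

Lemma sa_mulKV x y : x <> 0 -> sa_inv x ** (x ** y) = y.
Proof.
move=> x0; rewrite /sa_inv sa_mulZl mul_conjK scalerA.
by rewrite mulVf ?nsq_neq0 // scale1r.
Qed.

Lemma sa_inv0 : sa_inv (0 : A) = 0.
Proof. by rewrite /sa_inv nsq0 invr0 scale0r. Qed.

Lemma sa_re_div x y : sa_re (x ** sa_inv y) = (nsq y)^-1 * ip x y.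
Proof. by rewrite /sa_inv sa_mulZr sa_reZ. Qed.

(** Since J J = 2 re(J) J - n(J), an imaginary unit with nonzero real part would be a real number of
    square -1. Hence re(J) = 0, and then J J = - n(J) gives the norm. *)
Lemma imag_unitsP J : imag_units J <-> sa_re J = 0 /\ nsq J = 1.
Proof.
split=> [JJ|[J0 J1]]; last by rewrite /imag_units /= mul_re0 // J1 scale1r.
have J0 : sa_re J = 0.
  apply: contrapT => /eqP J0.
  have e : (2 * sa_re J) *: J = (nsq J - 1) *: sa_one A.
    have := mul_conj J hA; rewrite sa_conjE sa_mulBr sa_mulZr sa_mul1r JJ opprK.
    by move=> e; rewrite scalerBl scale1r -/(of_real A (nsq J)) -e addrK.
  have {e} Je : J = of_real A ((2 * sa_re J)^-1 * (nsq J - 1)).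
    by rewrite /of_real -scalerA -e scalerA mulVf ?scale1r // mulf_neq0 ?pnatr_eq0.
  set k := _ * _ in Je.
  have := congr1 (@sa_re R A) JJ; rewrite Je of_realM sa_reZ sa_re_of_real.
  rewrite sa_reN sa_re1 => kk; have := sqr_ge0 k; rewrite expr2 kk; lra.
split=> //; move: JJ; rewrite /imag_units /= mul_re0 // => /(congr1 (@sa_re R A)).
rewrite !sa_reN sa_reZ sa_re1; lra.
Qed.

Lemma imag_unitsN J : imag_units J -> imag_units (- J).
Proof.
by move=> /imag_unitsP[J0 J1]; apply/imag_unitsP; rewrite sa_reN nsqN J0 oppr0.
Qed.

Lemma re0_scale b J : imag_units J -> sa_re (b *: J) = 0.
Proof. by move=> /imag_unitsP[J0 _]; rewrite sa_reZ J0 mulr0. Qed.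

Lemma nsq_scale b J : imag_units J -> nsq (b *: J) = b ^+ 2.
Proof. by move=> /imag_unitsP[_ J1]; rewrite nsqZ J1 mulr1. Qed.


(** * Spheres and slice functions *)

Lemma slice_sphere_intro k b I J : imag_units I -> imag_units J ->
  slice_sphere (of_real A k + b *: I) (of_real A k + b *: J).
Proof. by move=> *; exists k, b, I, J. Qed.

(** An imaginary element is its length times a unit. Membership in a sphere thus becomes two
    equations suited to norm computations. *)
Lemma slice_sphereP x y : @imag_units R A !=set0 ->
  slice_sphere x y <-> sa_re y = sa_re x /\ nsq (sa_im y) = nsq (sa_im x).
Proof.
move=> [K uK]; split=> [[a [b [J [I [uJ uI -> ->]]]]]|[re_eq nsq_eq]].
  by rewrite !sa_re_decomp ?sa_im_decomp ?re0_scale // !nsq_scale.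
have unit_dir z : exists2 J, imag_units J & sa_im z = Num.sqrt (nsq (sa_im z)) *: J.
  have [z0|z0] := eqVneq (sa_im z) 0.
    (* A zero imaginary part has no direction of its own: any unit serves, with coefficient 0. *)
    by exists K; rewrite // z0 nsq0 sqrtr0 scale0r.
  have n_gt0 : 0 < nsq (sa_im z).
    rewrite lt_def nsq_ge0 andbT; apply/nsq_neq0/eqP => //.
  have s0 : Num.sqrt (nsq (sa_im z)) != 0 by rewrite gt_eqF ?sqrtr_gt0.
  exists ((Num.sqrt (nsq (sa_im z)))^-1 *: sa_im z); last first.
    by rewrite scalerA divff // scale1r.
  apply/imag_unitsP; rewrite sa_reZ sa_re_im mulr0 nsqZ exprVn sqr_sqrtr ?ltW //.
  by rewrite mulVf ?gt_eqF.
have [J uJ xJ] := unit_dir x; have [I uI yI] := unit_dir y.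
rewrite (sa_re_im_decomp x) (sa_re_im_decomp y) xJ yI re_eq nsq_eq.
exact: slice_sphere_intro.
Qed.

Lemma sa_im_re0 x : ~ real_axis x -> sa_im x <> 0.
Proof.
move=> xr x0; apply: xr; exists (sa_re x) => //.
by rewrite {2}(sa_re_im_decomp x) x0 addr0.
Qed.

Lemma sa_im_real x : real_axis x -> sa_im x = 0.
Proof. by move=> [k _ <-]; rewrite sa_imE sa_re_of_real subrr. Qed.

Section SliceFunctions.
Variable D : set R[i].
Hypothesis Dconj : conj_invariant D.
Implicit Types (f g h : A -> A).

Lemma circularization_unit x : circularization D x -> @imag_units R A !=set0.
Proof. by move=> [a [b [J [uJ _ _]]]]; exists J. Qed.

(** Comparing real parts and norms of imaginary parts determines a, and b up to sign; conjugation
    invariance of D absorbs the sign. *)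
Lemma circularizationP a b J : imag_units J ->
  circularization D (of_real A a + b *: J) <-> D (Complex a b).
Proof.
move=> uJ; split=> [[a' [b' [I [uI Dab e]]]]|Dab]; last by exists a, b, J.
have := congr1 (@sa_re R A) e; rewrite !sa_re_decomp ?re0_scale // => ->.
have := congr1 (fun z => nsq (sa_im z)) e.
rewrite !sa_im_decomp ?re0_scale // !nsq_scale // => /eqP.
rewrite eqf_sqr => /orP[]/eqP -> //.
exact: Dconj Dab.
Qed.

Lemma slice_sphere_circ x y :
  circularization D x -> slice_sphere x y -> circularization D y.
Proof.
move=> Dx [a [b [J [I [uJ uI xE ->]]]]]; apply/circularizationP => //.
by apply/(circularizationP _ _ uJ); rewrite -xE.
Qed.

Lemma slice_sphere_refl x : circularization D x -> slice_sphere x x.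
Proof. by move=> [a [b [J [uJ _ ->]]]]; exact: slice_sphere_intro. Qed.

Lemma conj_scale a b J : imag_units J ->
  (of_real A a + b *: J)^c = of_real A a + (- b) *: J.
Proof. by move=> uJ; rewrite conj_decomp ?re0_scale // scaleNr. Qed.

Lemma slice_sphere_conj x y : slice_sphere x y -> slice_sphere x y^c.
Proof.
move=> [a [b [J [I [uJ uI -> ->]]]]]; rewrite conj_scale // scaleNr -scalerN.
by apply: slice_sphere_intro => //; exact: imag_unitsN.
Qed.

(** A real z is its own conjugate, so F2 z = - F2 z. This covers b = 0, where one cannot divide by
    b. *)
Lemma stem_real (F1 F2 : R[i] -> A) (z : R[i]) :
  stem D F1 F2 -> D z -> complex.Im z = 0 -> F2 z = 0.
Proof.
case: z => a b hF Dab /= b0; have [_ /=] := hF _ Dab.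
rewrite b0 oppr0 => /eqP; rewrite -addr_eq0.
by rewrite -mulr2n -scaler_nat scaler_eq0 pnatr_eq0 => /eqP.
Qed.

Lemma sph_val_stem F1 F2 f a b J :
  stem D F1 F2 -> induces D F1 F2 f -> D (Complex a b) -> imag_units J ->
  sph_val f (of_real A a + b *: J) = F1 (Complex a b).
Proof.
move=> hF hf Dab uJ; rewrite /sph_val conj_scale // !hf //; last exact: Dconj Dab.
have [/= -> ->] := hF _ Dab.
rewrite sa_mulNr addrACA subrr addr0 -mulr2n -scaler_nat scalerA.
by rewrite mulVf ?pnatr_eq0 // scale1r.
Qed.

(* For b = 0 both sides vanish, since the inverse of 0 is 0. *)
Lemma sph_der_stem F1 F2 f a b J :
  stem D F1 F2 -> induces D F1 F2 f -> D (Complex a b) -> imag_units J ->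
  sph_der f (of_real A a + b *: J) = b^-1 *: F2 (Complex a b).
Proof.
move=> hF hf Dab uJ.
rewrite /sph_der conj_scale // !hf //; last exact: Dconj Dab.
rewrite sa_im_decomp ?re0_scale //.
have [/= -> ->] := hF _ Dab.
rewrite sa_mulNr opprD opprK addrACA subrr add0r -mulr2n -scaler_nat.
rewrite sa_mulZr scalerA mulVf ?pnatr_eq0 // scale1r.
have [->|b0] := eqVneq b 0; first by rewrite scale0r sa_inv0 sa_mul0l invr0 scale0r.
have J1 : nsq J = 1 by have [_] := (imag_unitsP J).1 uJ.
have bJ0 : b *: J <> 0.
  move=> bJ0; have := nsq_scale b uJ; rewrite bJ0 nsq0 => /esym/eqP.
  by rewrite sqrf_eq0 (negPf b0).
(* Moving b onto J makes the left factor im(x), which its inverse cancels. *)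
have -> : J ** F2 (Complex a b) = (b *: J) ** (b^-1 *: F2 (Complex a b)).
  by rewrite sa_mulZl sa_mulZr scalerA divff // scale1r.
exact: sa_mulKV.
Qed.

Lemma slice_fun_decomp f x : slice_fun D f -> circularization D x ->
  f x = sph_val f x + sa_im x ** sph_der f x.
Proof.
move=> [F1 [F2 [hF hf]]] [a [b [J [uJ Dab ->]]]].
rewrite (sph_val_stem hF hf) // (sph_der_stem hF hf) // hf //.
rewrite sa_im_decomp ?re0_scale // sa_mulZr sa_mulZl scalerA.
have [b0|b0] := eqVneq b 0; last by rewrite mulVf // scale1r.
suff -> : F2 (Complex a b) = 0 by rewrite sa_mul0r scaler0.
by apply: stem_real hF Dab _.
Qed.

(** The spherical value and derivative depend on a and b alone, so their values at x serve the whole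
    sphere. *)
Lemma slice_fun_sphere f x y : slice_fun D f -> circularization D x ->
  slice_sphere x y -> f y = sph_val f x + sa_im y ** sph_der f x.
Proof.
move=> hf Dx xy; have Dy := slice_sphere_circ Dx xy.
rewrite (slice_fun_decomp hf Dy).
case: hf xy Dx => [F1 [F2 [hF hf]]] [a [b [J [I [uJ uI -> ->]]]]].
move=> /(circularizationP _ _ uJ) Dab.
by rewrite !(sph_val_stem hF hf) // !(sph_der_stem hF hf).
Qed.


(* The right-hand side depends on f and g only, not on the choice of stem
   functions: this makes [slice_prod] well defined on the circular set. *)
Lemma stem_prod_sph F1 F2 G1 G2 f g a b J :
  stem D F1 F2 -> induces D F1 F2 f -> stem D G1 G2 -> induces D G1 G2 g ->
  D (Complex a b) -> imag_units J ->
  let z := Complex a b in let x := of_real A a + b *: J in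
  F1 z ** G1 z - F2 z ** G2 z + J ** (F1 z ** G2 z + F2 z ** G1 z) =
  sph_val f x ** sph_val g x - nsq (sa_im x) *: (sph_der f x ** sph_der g x)
  + sa_im x ** (sph_val f x ** sph_der g x + sph_der f x ** sph_val g x).
Proof.
move=> hF hf hG hg Dab uJ z x; rewrite /x.
rewrite !(sph_val_stem hF hf) // !(sph_der_stem hF hf) //.
rewrite !(sph_val_stem hG hg) // !(sph_der_stem hG hg) //.
rewrite sa_im_decomp ?re0_scale // nsq_scale // -/z.
rewrite !(sa_mulZl, sa_mulZr) -scalerDr (sa_mulZr _ J) !scalerA.
(* For b nonzero, n(im x) = b^2 cancels the two factors b^-1; for b = 0 both odd components
   vanish. *)
have [b0|b0] := eqVneq b 0; last first.
  by rewrite divff // expr2 mulfK // divff // !scale1r.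
have F20 : F2 z = 0 by exact: (stem_real (z := z) hF Dab b0).
have G20 : G2 z = 0 by exact: (stem_real (z := z) hG Dab b0).
by rewrite F20 G20 !(sa_mul0r, sa_mul0l) addr0 sa_mul0r !scaler0.
Qed.

Lemma slice_prodE f g x : slice_fun D f -> slice_fun D g -> circularization D x ->
  slice_prod D f g x =
  sph_val f x ** sph_val g x - nsq (sa_im x) *: (sph_der f x ** sph_der g x)
  + sa_im x ** (sph_val f x ** sph_der g x + sph_der f x ** sph_val g x).
Proof.
move=> [F1 [F2 [hF hf]]] [G1 [G2 [hG hg]]] [a [b [J [uJ Dab ->]]]].
(* The claimed formula is itself a slice product, so [xget] returns one. The stem functions of the
   returned one may differ, but [stem_prod_sph] gives them the same value. *)
have : is_slice_prod D f g (slice_prod D f g).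
  apply: xgetPex; exists (fun x =>
    sph_val f x ** sph_val g x - nsq (sa_im x) *: (sph_der f x ** sph_der g x)
    + sa_im x ** (sph_val f x ** sph_der g x + sph_der f x ** sph_val g x)).
  exists F1, F2, G1, G2; split=> // a' b' I Dab' uI.
  by rewrite (stem_prod_sph hF hf hG hg).
move=> [F1' [F2' [G1' [G2' [[hF' hf'] [hG' hg'] ->]]]]] //.
by rewrite (stem_prod_sph hF' hf' hG' hg').
Qed.

Lemma slice_prod_sphere f g x y : slice_fun D f -> slice_fun D g ->
  circularization D x -> slice_sphere x y ->
  slice_prod D f g y =
  sph_val f x ** sph_val g x - nsq (sa_im x) *: (sph_der f x ** sph_der g x)
  + sa_im y ** (sph_val f x ** sph_der g x + sph_der f x ** sph_val g x).
Proof.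
move=> hf hg Dx xy; have Dy := slice_sphere_circ Dx xy.
have [_ <-] := (slice_sphereP _ _ (circularization_unit Dx)).1 xy.
rewrite slice_prodE //.
case: hf hg xy Dx {Dy} => [F1 [F2 [hF hf]]] [G1 [G2 [hG hg]]].
move=> [a [b [J [I [uJ uI -> ->]]]]] /(circularizationP _ _ uJ) Dab.
by rewrite !(sph_val_stem hF hf, sph_val_stem hG hg,
  sph_der_stem hF hf, sph_der_stem hG hg).
Qed.

(** * Affine functions on a sphere and their zeros *)

Lemma sph_der_affine h x p q : circularization D x -> ~ real_axis x ->
  (forall y, slice_sphere x y -> h y = p + sa_im y ** q) -> sph_der h x = q.
Proof.
move=> Dx xr hE; have xx := slice_sphere_refl Dx.
rewrite /sph_der !hE //; last exact: slice_sphere_conj.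
rewrite sa_im_conj sa_mulNl opprD opprK addrACA subrr add0r -mulr2n -scaler_nat.
by rewrite sa_mulZr scalerA mulVf ?pnatr_eq0 // scale1r sa_mulKV //; exact: sa_im_re0.
Qed.

Lemma conj_neq x : ~ real_axis x -> x^c <> x.
Proof.
move=> xr /(congr1 (@sa_im R A)); rewrite sa_im_conj => /eqP.
rewrite eq_sym -addr_eq0 -mulr2n -scaler_nat scaler_eq0 pnatr_eq0 => /eqP.
exact: sa_im_re0.
Qed.

Lemma zeros_affine0 h x : circularization D x ->
  (forall y, slice_sphere x y -> h y = 0) -> slice_sphere x `<=` zeros D h.
Proof. by move=> Dx h0 y xy; split; [exact: slice_sphere_circ xy|exact: h0]. Qed.

(** The sphere of a nonreal x contains the distinct points x and x^c. *)
Lemma sphere_not_singleton h x w : circularization D x -> ~ real_axis x ->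
  slice_sphere x `<=` zeros D h -> slice_sphere x `&` zeros D h <> [set w].
Proof.
move=> Dx xr hx e; have xx := slice_sphere_refl Dx.
have xcx := slice_sphere_conj xx.
have : [set w] x by rewrite -e; split=> //; exact: hx.
have : [set w] x^c by rewrite -e; split=> //; exact: hx.
by move=> /= <- /esym; exact: conj_neq.
Qed.

(* A zero x + im y must satisfy im y = - p / q, and the two norm conditions say
   exactly that this element is imaginary of norm |im x|. *)
Lemma zeros_affine h x p q : circularization D x ->
  (forall y, slice_sphere x y -> h y = p + sa_im y ** q) ->
  q <> 0 -> ip p q = 0 -> nsq p = nsq (sa_im x) * nsq q ->
  slice_sphere x `&` zeros D h = [set (sa_re x *: q - p) ** sa_inv q].
Proof.
move=> Dx hE q0 pq0 pq_norm.
have sphP y := slice_sphereP x y (circularization_unit Dx).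
have wE : (sa_re x *: q - p) ** sa_inv q = of_real A (sa_re x) - p ** sa_inv q.
  by rewrite sa_mulBl -of_realM sa_mulK.
have u0 : sa_re (- (p ** sa_inv q)) = 0 by rewrite sa_reN sa_re_div pq0 mulr0 oppr0.
apply/seteqP; split=> y /=.
  move=> [xy [_ /eqP]]; rewrite hE // addrC addr_eq0 => /eqP yq.
  have {}yq : sa_im y = - (p ** sa_inv q).
    have := congr1 (fun z => z ** sa_inv q) yq.
    by rewrite sa_mulK // sa_mulNl.
  by rewrite wE [LHS]sa_re_im_decomp yq ((sphP y).1 xy).1.
move=> ->; rewrite wE.
have xw : slice_sphere x (of_real A (sa_re x) - p ** sa_inv q).
  apply/sphP; rewrite sa_re_decomp // sa_im_decomp // nsqN; split=> //.
  by apply: (mulIf (nsq_neq0 q0)); rewrite -pq_norm -nsqM sa_mulVK.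
split=> //; split; first exact: slice_sphere_circ xw.
by rewrite hE // sa_im_decomp // sa_mulNl sa_mulVK // subrr.
Qed.

(** If q = 0, a single zero forces p = 0, and h vanishes on the whole sphere, which is not a
    singleton. *)
Lemma zeros_singleton h x p q y : circularization D x -> ~ real_axis x ->
  (forall y, slice_sphere x y -> h y = p + sa_im y ** q) ->
  slice_sphere x `&` zeros D h = [set y] ->
  [/\ slice_sphere x y, q <> 0 & p = - (sa_im y ** q)].
Proof.
move=> Dx xr hE e.
have [xy [_ hy]] : (slice_sphere x `&` zeros D h) y by rewrite e.
have py : p = - (sa_im y ** q) by apply/eqP; rewrite -addr_eq0 -hE // hy.
split=> // q0; apply: (sphere_not_singleton (w := y) Dx xr _ e).
by apply: zeros_affine0 => // z xz; rewrite hE // py q0 !sa_mul0r oppr0 addr0.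
Qed.

(** Serves to contradict an empty zero set. For q = 0 the norm condition gives p = 0, and x is a
    zero. *)
Lemma zeros_affine_nonempty h x p q : circularization D x ->
  (forall y, slice_sphere x y -> h y = p + sa_im y ** q) ->
  ip p q = 0 -> nsq p = nsq (sa_im x) * nsq q ->
  slice_sphere x `&` zeros D h <> set0.
Proof.
move=> Dx hE pq0 pq_norm.
have [q0 e|/eqP q0] := eqVneq q 0; last first.
  by rewrite (zeros_affine Dx hE) // => /seteqP[/(_ _ erefl)].
have p0 : p = 0 by apply: nsq_eq0; rewrite pq_norm q0 nsq0 mulr0.
have xx := slice_sphere_refl Dx.
suff : (slice_sphere x `&` zeros D h) x by rewrite e.
by do 2!split=> //; rewrite hE // p0 q0 sa_mul0r addr0.
Qed.

End SliceFunctions.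

(** * Zeros of the slice product on a sphere *)

(* On the sphere of x, the slice product is y |-> p + im y ** q; here and in the
   next two lemmas p and q are computed when im y = v at a zero of the first factor
   (so that its spherical value is - (v ** b)), when im z = v at a zero of the
   second one, and when both factors vanish. The cross terms cancel by
   [ip_mul_exchange]. *)
Lemma norm_left_factor v b c d :
  sa_re v = 0 ->
  let p := - (v ** b) ** c - nsq v *: (b ** d) in
  let q := - (v ** b) ** d + b ** c in
  ip p q = 0 /\ nsq p = nsq v * nsq q.
Proof.
move=> v0 p q; have vb0 := ip_re0 b v0.
have e := ip_mul_exchange (v ** b) b c d; rewrite vb0 mulr0 mul0r in e.
(* [f] and [f'] kill the inner products of (v b) x with b x, in either order. *)
have f x := ip_mul2r x (v ** b) b; rewrite vb0 in f.
have f' x := ip_mul2r x b (v ** b); rewrite (ipC b) vb0 in f'.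
rewrite /p /q !(sa_mulNl, nsqD, nsqN, nsqZ) !ipE !ip_mul2l !f !f' !nsqM.
split; first by rewrite (ipC d c); ring.
(* By [e], the mixed term 2 n(v) <(v b) c, b d> of n(p) equals the mixed term -2 n(v) <(v b) d, b c>
   of n(v) n(q). *)
by move/eqP: e; rewrite addr_eq0 => /eqP ->; ring.
Qed.

Lemma norm_right_factor v a b d :
  sa_re v = 0 ->
  let p := - (a ** (v ** d)) - nsq v *: (b ** d) in
  let q := a ** d - b ** (v ** d) in
  ip p q = 0 /\ nsq p = nsq v * nsq q.
Proof.
move=> v0 p q; have vd0 := ip_re0 d v0.
have e := ip_mul_exchange a b (v ** d) d; rewrite vd0 mulr0 in e.
have f x := ip_mul2l x (v ** d) d; rewrite vd0 in f.
have f' x := ip_mul2l x d (v ** d); rewrite (ipC d) vd0 in f'.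
rewrite /p /q !(nsqD, nsqN, nsqZ) !ipE !ip_mul2r !f !f' !nsqM.
split; first by rewrite (ipC a b); ring.
by move/eqP: e; rewrite addr_eq0 => /eqP ->; ring.
Qed.

Lemma norm_both_factors v t b d :
  sa_re v = 0 -> sa_re t = 0 -> nsq v = nsq t ->
  let p := (v ** b) ** (t ** d) - nsq v *: (b ** d) in
  let q := - (v ** b) ** d - b ** (t ** d) in
  ip p q = 0 /\ nsq p = nsq v * nsq q.
Proof.
move=> v0 t0 vt p q; have vb0 := ip_re0 b v0; have td0 := ip_re0 d t0.
have e := ip_mul_exchange (v ** b) b (t ** d) d; rewrite vb0 mulr0 mul0r in e.
have f x := ip_mul2r x (v ** b) b; rewrite vb0 in f.
have f' x := ip_mul2r x b (v ** b); rewrite (ipC b) vb0 in f'.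
have g x := ip_mul2l x (t ** d) d; rewrite td0 in g.
have g' x := ip_mul2l x d (t ** d); rewrite (ipC d) td0 in g'.
rewrite /p /q !(sa_mulNl, nsqD, nsqN, nsqZ) !ipE !f !f' !g !g' !nsqM -vt.
split; first by ring.
by move/eqP: e; rewrite addr_eq0 => /eqP ->; ring.
Qed.

(** The equation says that the denominator vanishes. Pairing it with b d gives n(b) <c, d> = n(d) <v
    b, b> = 0; taking norms gives the rest. *)
Lemma cancel_left_factor v b c d : sa_re v = 0 -> b <> 0 ->
  b ** c = (v ** b) ** d -> ip c d = 0 /\ nsq c = nsq v * nsq d.
Proof.
move=> v0 /nsq_neq0 b0 e; split; apply: (mulfI b0).
  by rewrite -ip_mul2l e ip_mul2r ip_re0 // !mulr0.
by rewrite -(nsqM b c) e !nsqM; ring.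
Qed.

(** Mirror image: pairing with b d gives n(d) <a, b> = n(b) <v d, d> = 0. *)
Lemma cancel_right_factor v a b d : sa_re v = 0 -> d <> 0 ->
  a ** d = b ** (v ** d) -> ip a b = 0 /\ nsq a = nsq v * nsq b.
Proof.
move=> v0 /nsq_neq0 d0 e; split; apply: (mulfI d0).
  by rewrite -ip_mul2r e ip_mul2l ip_re0 // !mulr0.
by rewrite mulrC -(nsqM a d) e !nsqM; ring.
Qed.

(** Identifies the stated numerator of w with k q - p, the one found by [zeros_affine].
    Distributivity and v v = - n(v) suffice. *)
Lemma num_left_factor k v b c d : sa_re v = 0 -> let y := of_real A k + v in
  (y ** b) ** c - ((y ** v) ** b) ** d =
  k *: (- (v ** b) ** d + b ** c) - (- (v ** b) ** c - nsq v *: (b ** d)).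
Proof.
move=> v0 y; rewrite /y !(sa_mulDl, of_realM, sa_mulZl) (mul_re0 v0).
rewrite !(sa_mulNl, sa_mulZl, sa_mul1l) scalerDr scalerN !opprD !opprK.
by rewrite addrACA (addrC (k *: (b ** c))).
Qed.

Lemma num_right_factor k v a b d : sa_re v = 0 -> let z := of_real A k + v in
  a ** (z ** d) - b ** ((z ** v) ** d) =
  k *: (a ** d - b ** (v ** d)) - (- (a ** (v ** d)) - nsq v *: (b ** d)).
Proof.
move=> v0 z; rewrite /z !(sa_mulDl, of_realM, sa_mulZl) (mul_re0 v0).
rewrite !(sa_mulNl, sa_mulZl, sa_mul1l) !(sa_mulDr, sa_mulNr, sa_mulZr).
by rewrite scalerDr scalerN !opprD !opprK addrACA.
Qed.

(** As n(y) = k^2 + n(v), the two terms k^2 (b d) cancel. *)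
Lemma num_both_factors k v t b d : sa_re v = 0 ->
  let y := of_real A k + v in let z := of_real A k + t in
  nsq y *: (b ** d) - (y ** b) ** (z ** d) =
  k *: (- (v ** b) ** d - b ** (t ** d))
  - ((v ** b) ** (t ** d) - nsq v *: (b ** d)).
Proof.
move=> v0 y z; rewrite nsq_re_im sa_re_decomp // sa_im_decomp // /y /z.
rewrite !(sa_mulDl, sa_mulDr, of_realM, sa_mulZl, sa_mulZr).
rewrite !(sa_mulNl, sa_mulZl) scalerDl scalerBr scalerN expr2.
rewrite -scalerA scalerDr; set P := k *: (k *: _); set N := nsq v *: _.
set S := k *: (b ** _); set T := k *: (_ ** d); set Q := _ ** (t ** d).
rewrite opprB (opprD (P + S)) addrA (opprD P) addrACA subrr add0r opprD.
by rewrite (addrACA N) (addrACA (- T)) (addrC N).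
Qed.

Lemma conj_den_both_factors k v t b d : sa_re v = 0 ->
  let y := of_real A k + v in let z := of_real A k + t in
  (y^c ** b) ** d - b ** (z ** d) = - (v ** b) ** d - b ** (t ** d).
Proof.
move=> v0 y z; rewrite conj_decomp // !(sa_mulDl, sa_mulDr, of_realM, sa_mulZl, sa_mulZr).
by rewrite !sa_mulNl opprD addrACA addrA subrr add0r.
Qed.

End CompositionAlgebra.

Theorem theorem3p4 (R : realType) (A : starAlg R) (hA : is_CHO A)
    (D : set R[i]) (D0 : D !=set0) (Dconj : conj_invariant D)
    (f g : A -> A) (hf : slice_fun D f) (hg : slice_fun D g) :
  let Omega : set A := circularization D in
  let fg : A -> A := slice_prod D f g in
  let V : (A -> A) -> set A := zeros D in
  (forall x, Omega x -> real_axis x -> (V f `|` V g) x -> V fg x) /\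
  (forall x, Omega x ->
     slice_sphere x `<=` V f \/ slice_sphere x `<=` V g -> slice_sphere x `<=` V fg) /\
  (forall x, Omega x -> ~ real_axis x ->
     [/\ (forall y, slice_sphere x `&` V f = [set y] -> slice_sphere x `&` V g = set0 ->
            let num := (y ** sph_der f x) ** sph_val g x
                       - ((y ** sa_im y) ** sph_der f x) ** sph_der g x in
            let den := sph_der f x ** sph_val g x
                       - (sa_im y ** sph_der f x) ** sph_der g x in
            den <> 0 /\ slice_sphere x `&` V fg = [set num ** sa_inv den]),
         (forall z, slice_sphere x `&` V f = set0 -> slice_sphere x `&` V g = [set z] ->
            let num := sph_val f x ** (z ** sph_der g x)
                       - sph_der f x ** ((z ** sa_im z) ** sph_der g x) in
            let den := sph_val f x ** sph_der g x
                       - sph_der f x ** (sa_im z ** sph_der g x) in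
            den <> 0 /\ slice_sphere x `&` V fg = [set num ** sa_inv den]) &
         (forall y z, slice_sphere x `&` V f = [set y] -> slice_sphere x `&` V g = [set z] ->
            let num := nsq x *: (sph_der f x ** sph_der g x)
                       - (y ** sph_der f x) ** (z ** sph_der g x) in
            let den := sph_der fg x in
            let case_a := slice_sphere x `<=` V fg in
            let case_b := slice_sphere x `&` V fg = [set num ** sa_inv den] in
            [/\ den = (y^c ** sph_der f x) ** sph_der g x
                      - sph_der f x ** (z ** sph_der g x),
                case_a \/ case_b,
                case_a <-> den = 0 &
                case_b <-> den <> 0])]).
Proof.
move=> Omega fg V.
have fg_sphere x y := @slice_prod_sphere R A hA D Dconj f g x y hf hg.
have f_sphere x y := @slice_fun_sphere R A hA D Dconj f x y hf.
have g_sphere x y := @slice_fun_sphere R A hA D Dconj g x y hg.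
split.
  move=> x Dx xr hx; split=> //.
  (* At a real point im(x) = 0, and the formulas reduce to (f g)(x) = f(x) g(x). *)
  have x0 := sa_im_real hA xr.
  rewrite /fg slice_prodE // x0 nsq0 // scale0r subr0 sa_mul0l // addr0.
  case: hx => -[_]; rewrite (slice_fun_decomp hA Dconj) // x0 sa_mul0l // addr0 => ->.
    exact: sa_mul0l.
  exact: sa_mul0r.
split.
  move=> x Dx hx y xy; have Dy := slice_sphere_circ hA Dconj Dx xy.
  split=> //; rewrite /fg slice_prodE //.
  (* One factor vanishes at both y and y^c, hence so do its spherical value and derivative at y. *)
  have xyc := slice_sphere_conj hA xy.
  case: hx => hx; have [_ hy] := hx _ xy; have [_ hyc] := hx _ xyc.
    have -> : sph_val f y = 0 by rewrite /sph_val hy hyc addr0 scaler0.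
    have -> : sph_der f y = 0 by rewrite /sph_der hy hyc subr0 sa_mul0r // scaler0.
    by rewrite !(sa_mul0l hA, sa_mul0r hA, scaler0, addr0, subr0).
  have -> : sph_val g y = 0 by rewrite /sph_val hy hyc addr0 scaler0.
  have -> : sph_der g y = 0 by rewrite /sph_der hy hyc subr0 sa_mul0r // scaler0.
  by rewrite !(sa_mul0l hA, sa_mul0r hA, scaler0, addr0, subr0).
move=> x Dx xr.
have sphP y := slice_sphereP hA x y (circularization_unit Dx).
have fE y := f_sphere x y Dx; have gE y := g_sphere x y Dx.
have fgE y := fg_sphere x y Dx.
set a := sph_val f x in fE fgE *; set b := sph_der f x in fE fgE *.
set c := sph_val g x in gE fgE *; set d := sph_der g x in gE fgE *.
split.
- move=> y fy g0 num den.
  have [xy b0 ay] := zeros_singleton hA Dconj Dx xr fE fy.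
  have [re_y im_y] := (sphP y).1 xy.
  set v := sa_im y in ay im_y *; have v0 : sa_re v = 0 by exact: sa_re_im.
  have denE : den = - (v ** b) ** d + b ** c by rewrite /den -/v sa_mulNl // addrC.
  have {}fgE w : slice_sphere x w -> slice_prod D f g w =
      - (v ** b) ** c - nsq v *: (b ** d) + sa_im w ** den.
    by move=> xw; rewrite fgE // denE ay -im_y.
  (* Otherwise g would meet the two conditions for having a zero on the sphere, against [g0]. *)
  have den0 : den <> 0.
    move=> /eqP; rewrite subr_eq0 => /eqP /(cancel_left_factor hA v0 b0) [cd0 cd].
    by apply: (zeros_affine_nonempty hA Dconj Dx gE cd0 _ g0); rewrite -im_y.
  split=> //; have [pq pq_norm] := norm_left_factor hA b c d v0.
  rewrite -denE in pq pq_norm.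
  rewrite (zeros_affine hA Dconj Dx fgE) -?im_y //.
  (* Only the two explicit factors y are split; the y inside im(y) stays. *)
  congr [set _ ** _]; rewrite denE /num {1 2}(sa_re_im_decomp hA y).
  by rewrite num_left_factor // re_y.
- move=> z f0 gz num den.
  have [xz d0 cz] := zeros_singleton hA Dconj Dx xr gE gz.
  have [re_z im_z] := (sphP z).1 xz.
  set v := sa_im z in cz im_z *; have v0 : sa_re v = 0 by exact: sa_re_im.
  have {}fgE w : slice_sphere x w -> slice_prod D f g w =
      - (a ** (v ** d)) - nsq v *: (b ** d) + sa_im w ** den.
    by move=> xw; rewrite fgE // cz -im_z !sa_mulNr.
  have den0 : den <> 0.
    move=> /eqP; rewrite subr_eq0 => /eqP /(cancel_right_factor hA v0 d0) [ab0 ab].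
    by apply: (zeros_affine_nonempty hA Dconj Dx fE ab0 _ f0); rewrite -im_z.
  split=> //; have [pq pq_norm] := norm_right_factor hA a b d v0.
  rewrite (zeros_affine hA Dconj Dx fgE) -?im_z //.
  congr [set _ ** _]; rewrite /num {1 2}(sa_re_im_decomp hA z).
  by rewrite num_right_factor // re_z.
- move=> y z fy gz num den case_a case_b.
  have [xy b0 ay] := zeros_singleton hA Dconj Dx xr fE fy.
  have [xz d0 cz] := zeros_singleton hA Dconj Dx xr gE gz.
  have [re_y im_y] := (sphP y).1 xy; have [re_z im_z] := (sphP z).1 xz.
  set v := sa_im y in ay im_y; have v0 : sa_re v = 0 by exact: sa_re_im.
  set t := sa_im z in cz im_z; have t0 : sa_re t = 0 by exact: sa_re_im.
  have vt : nsq v = nsq t := etrans im_y (esym im_z).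
  have nxy : nsq x = nsq y by rewrite (nsq_re_im hA x) (nsq_re_im hA y) re_y -/v im_y.
  have denE : den = - (v ** b) ** d - b ** (t ** d).
    (* The affine form of the product on the sphere yields its spherical derivative directly, with
       no stem functions for the product. *)
    rewrite /den (sph_der_affine hA Dx xr fgE) ay cz !(sa_mulNl, sa_mulNr) //.
  have {}fgE w : slice_sphere x w -> slice_prod D f g w =
      ((v ** b) ** (t ** d) - nsq v *: (b ** d)) + sa_im w ** den.
    move=> xw; rewrite fgE // denE ay cz -im_y.
    by rewrite !(sa_mulNl, sa_mulNr) // opprK.
  have [pq pq_norm] := norm_both_factors hA b d v0 t0 vt.
  rewrite -denE in pq pq_norm.
  have a_of0 : den = 0 -> case_a.
    move=> den0; apply: zeros_affine0 => // w xw; rewrite /fg fgE // den0 sa_mul0r //.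
    (* With q = 0 the norm identity leaves n(p) = 0, so p = 0 too. *)
    rewrite den0 nsq0 // mulr0 in pq_norm.
    by rewrite addr0; exact: (nsq_eq0 hA).
  have b_ofN0 : den <> 0 -> case_b.
    move=> den0; rewrite /case_b (zeros_affine hA Dconj Dx fgE) -?im_y //.
    congr [set _ ** _].
    rewrite /num nxy (sa_re_im_decomp hA y) (sa_re_im_decomp hA z) re_y re_z.
    rewrite num_both_factors //.
    by rewrite denE.
  (* As (a) and (b) exclude each other, the two implications from [den] become equivalences. *)
  have a_not_b : case_a -> ~ case_b by exact: sphere_not_singleton.
  have a_den0 : case_a -> den = 0.
    by move=> ha; apply: contrapT => /b_ofN0; exact: a_not_b.
  split.
  + rewrite denE (sa_re_im_decomp hA y) (sa_re_im_decomp hA z) re_y re_z.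
    by rewrite conj_den_both_factors.
  + by have [/eqP/a_of0|/eqP/b_ofN0] := boolP (den == 0); [left|right].
  + by split.
  + by split=> // hb /a_of0 /a_not_b.
Qed.
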